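(* Let $f$ be a +proper, closed relation on a uniform space $X$. Let $\mathcal L\subset\mathcal B_{\mathcal U}(X)$ be a sufficient set of elementary uniform Lyapunov functions for $f$ and let $\mathcal A$ be the closed subalgebra generated by $\mathcal L$ and the continuous functions with compact support. If $(\hat X,\hat f)$ is the $\mathcal L$ compactification of the dynamical system $(X,f)$ (the compactification associated with $\mathcal A$), then $(\hat X,\hat f)$ is a chain dynamic compactification of $(X,f)$. Furthermore, if $\hat E\subset|\mathcal C\hat f|$ is a $\mathcal C\hat f\cap\mathcal C\hat f^{-1}$ equivalence class with $E=\hat E\cap X$, then exactly one of the following three possibilities holds: (i) $\hat E$ consists of a single point of $\hat X\setminus X$. (ii) $E$ is contained in $|\mathcal Cf|$ and is a noncompact $\mathcal Cf\cap\mathcal Cf^{-1}$ equivalence class with $\hat E$ its one point compactification; that is, there is a noncompact equivalence class $E\subset|\mathcal Cf|$ whose closure in $\hat X$ is $\hat E$, and $\hat E\setminus E$ is a singleton. (iii) $\hat E=E$ is contained in $|\mathcal Cf|$ and is a compact $\mathcal Cf\cap\mathcal Cf^{-1}$ equivalence class. If $f$ is a uniformly continuous proper map and $\mathcal L$ is $f^*$ +invariant, then $(\hat X,\hat f)$ is a cascade compactification (i.e. $\hat f$ is a continuous map on $\hat X$). If $f$ is a uniform isomorphism and $\mathcal L$ is $f^*$ invariant, then $(\hat X,\hat f)$ is reversible (i.e. $\hat f$ is a homeomorphism of $\hat X$).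
   Context: $X$ is a locally compact, $\sigma$-compact Hausdorff space equipped with a uniformity $\mathcal U_X$ compatible with its topology; a compact Hausdorff space carries its unique uniformity (all neighborhoods of the diagonal). A relation $f$ on $X$ is a subset of $X\times X$ (maps are identified with their graphs); $f(A)=\{y:(x,y)\in f\text{ for some }x\in A\}$, $f^{-1}=\{(y,x):(x,y)\in f\}$, $g\circ f=\{(x,z):\exists y,\ (x,y)\in f,\ (y,z)\in g\}$, $|f|=\{x:(x,x)\in f\}$, $1_X$ is the diagonal. $f$ is closed if closed in $X\times X$; +proper if closed and $f(A)$ is compact for every compact $A$. $\mathcal Of=\bigcup_{n\ge1}f^n$. The chain relation of a +proper closed relation is $\mathcal Cf=\bigcap_{V\in\mathcal U_X}\mathcal O(V\circ f)$, a closed transitive relation; $\mathcal Cf^{-1}=(\mathcal Cf)^{-1}$, and $\mathcal Cf\cap\mathcal Cf^{-1}$ restricts to an equivalence relation on $|\mathcal Cf|$, whose classes are the $\mathcal Cf\cap\mathcal Cf^{-1}$ equivalence classes. $\mathcal B(X)$ is the Banach algebra of bounded continuous real functions with the sup norm, and $\mathcal B_{\mathcal U}(X)$ its closed subalgebra of uniformly continuous functions. A proper compactification of $X$ is a compact Hausdorff space $\hat X$ containing $X$ as a dense (hence open) topological subspace; it corresponds to the closed subalgebra of $\mathcal B(X)$ of functions which extend continuously to $\hat X$, and every closed subalgebra (containing the constants) distinguishing points from closed sets arises from a unique (up to homeomorphism) such $\hat X$. $\hat f$ is the closure of $f$ in $\hat X\times\hat X$. $(\hat X,\hat f)$ is chain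 dynamic if it is a proper compactification, the inclusion $X\to\hat X$ is uniformly continuous, and $(X\times X)\cap\mathcal C\hat f=\mathcal Cf$. An elementary uniform Lyapunov function for $f$ is a uniformly continuous $L:X\to[0,1]$ such that $(x,y)\in f$ implies $L(x)=0$ or $L(y)=1$. With $\le_L=\{(x,y):L(x)\le L(y)\}$, a set $\mathcal L$ of such functions is sufficient if $1_X\cup\mathcal Cf=\bigcap_{L\in\mathcal L}\le_L$. For a map $f$, $f^*(u)=u\circ f$; $\mathcal L$ is $f^*$ +invariant if $f^*(\mathcal L)\subset\mathcal L$ and $f^*$ invariant if $f^*(\mathcal L)=\mathcal L$. A continuous map is proper if preimages of compact sets are compact. *)

(* Defs.v *)
From HB Require Import structures.
From mathcomp Require Import all_boot all_order all_algebra.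
From mathcomp Require Import all_classical all_reals all_analysis.

Set Implicit Arguments.
Unset Strict Implicit.
Unset Printing Implicit Defensive.

Import Order.TTheory GRing.Theory Num.Theory.
Import numFieldNormedType.Exports.

Local Open Scope classical_set_scope.
Local Open Scope ring_scope.
Local Open Scope relation_scope.

Definition exactly_one_of3 (P Q S : Prop) : Prop :=
  (P \/ Q \/ S) /\ ~ (P /\ Q) /\ ~ (P /\ S) /\ ~ (Q /\ S).

Definition sigma_compact (X : topologicalType) : Prop :=
  exists K : nat -> set X, (forall n, compact (K n)) /\ \bigcup_n K n = setT.

(** The notation [g \; f] of [relation_scope] is the composition
    that applies [f] first: (x, z) is in [g \; f] iff (x, y) is in [f] and
    (y, z) is in [g] for some y. *)

Definition graph {T U : Type} (g : T -> U) : set (T * U) :=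
  [set xy | xy.2 = g xy.1].

Definition rel_image {T U : Type} (f : set (T * U)) (A : set T) : set U :=
  [set y | exists2 x, A x & f (x, y)].

Fixpoint rel_pow {T : Type} (f : set (T * T)) (n : nat) : set (T * T) :=
  if n is m.+1 then f \; rel_pow f m else diagonal.

Definition orbit_rel {T : Type} (f : set (T * T)) : set (T * T) :=
  \bigcup_(n in [set n | (0 < n)%N]) rel_pow f n.

Definition cyclic_set {T : Type} (f : set (T * T)) : set T :=
  [set x | f (x, x)].

Definition plus_proper {X : topologicalType} (f : set (X * X)) : Prop :=
  closed f /\ forall A : set X, compact A -> compact (rel_image f A).

Definition chain_rel {X : uniformType} (f : set (X * X)) : set (X * X) :=
  \bigcap_(V in @entourage X) orbit_rel (V \; f).

Definition chain_class {X : uniformType} (f : set (X * X)) (E : set X) : Prop :=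
  exists2 x, cyclic_set (chain_rel f) x &
    E = [set y | cyclic_set (chain_rel f) y /\
                 (chain_rel f `&` (chain_rel f)^-1) (x, y)].

Definition bounded_continuous {R : realType} {X : topologicalType} :
    set (X -> R) :=
  [set u | continuous u /\ [bounded u x | x in [set: X]]].

Definition bounded_unif_continuous {R : realType} {X : uniformType} :
    set (X -> R) :=
  [set u | unif_continuous u /\ [bounded u x | x in [set: X]]].

Definition compactly_supported {R : realType} {X : topologicalType} :
    set (X -> R) :=
  [set u | continuous u /\ compact (closure [set x | u x != 0])].

(* Stability under scalar multiplication follows from the constants; the last
   clause is closedness for the sup norm. *)
Definition closed_subalgebra {R : realType} {X : topologicalType}
    (A : set (X -> R)) : Prop :=
  [/\ A `<=` bounded_continuous,
      (forall c : R, A (cst c)),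
      (forall u v, A u -> A v -> A (u \+ v)),
      (forall u v, A u -> A v -> A (u \* v)) &
      (forall u, bounded_continuous u ->
         (forall e : R, 0 < e -> exists2 v, A v & forall x, `|u x - v x| <= e) ->
         A u)].

Definition generated_closed_subalgebra {R : realType} {X : topologicalType}
    (S : set (X -> R)) : set (X -> R) :=
  \bigcap_(A in [set A | closed_subalgebra A /\ S `<=` A]) A.

Definition elementary_lyapunov {R : realType} {X : uniformType}
    (f : set (X * X)) (L : X -> R) : Prop :=
  [/\ unif_continuous L,
      (forall x, 0 <= L x <= 1) &
      (forall x y, f (x, y) -> L x = 0 \/ L y = 1)].

Definition le_rel {R : realType} {X : Type} (L : X -> R) : set (X * X) :=
  [set xy | L xy.1 <= L xy.2].

Definition sufficient {R : realType} {X : uniformType}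
    (f : set (X * X)) (LL : set (X -> R)) : Prop :=
  diagonal `|` chain_rel f = \bigcap_(L in LL) le_rel L.

(** [X] is regarded as a subspace of [Xhat] through [iota].
    The uniformity carried by a compact [Xhat] is not an additional choice, see
    [compact_entourageE]. *)

Lemma compact_entourageE (T : uniformType) (V : set (T * T)) :
  compact [set: T] -> entourage V <-> (forall x : T, nbhs (x, x) V).
Proof.
move=> /compact_near_coveringP cT; split=> [entV x|nV].
  have entW := entourage_split_ent entV.
  exists (xsection (split_ent V)^-1 x, xsection (split_ent V) x) => /=.
    by split; apply: nbhs_entourage => //; exact: entourage_inv.
  case=> y z /= [/xsectionP yx /xsectionP xz].
  by apply: (entourage_split x).
have [[x0 _]|T0] := pselect (exists x : T, True); last first.
  by apply: filterS (filterT : entourage [set: T * T]) => -[x]; case: T0; exists x.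
have entPF : ProperFilter (@entourage T).
  split; last exact: entourage_filter.
  by move=> /entourage_diagonal_subproof /(_ (x0, x0)); apply.
have /cT : forall x, [set: T] x -> \forall x' \near x &
    E \near powerset_filter_from (@entourage T),
    forall y, E (x', y) -> V (x', y).
  move=> x _; have [[A B] /= [nA nB] ABV] := nV x.
  move: nB; rewrite -nbhs_entourageE => -[E entE EB].
  have entW := entourage_split_ent entE.
  exists (A `&` xsection (split_ent E) x,
      [set W | W `<=` split_ent E]) => /=.
    split; first by apply: filterI => //; exact: nbhs_entourage.
    exact: small_set_sub.
  case=> x' W /= [[Ax' /xsectionP xx'] WE] y Wx'y.
  apply: ABV; split=> //=; apply: EB; apply/xsectionP.
  by apply: (entourage_split x') => //; exact: WE.
move=> H.
have [E [entE EV]] := filter_ex (filterI (near_small_set entPF) H).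
by apply: filterS entE => -[x y] /EV; exact.
Qed.

Definition topological_embedding {X Y : topologicalType} (iota : X -> Y) : Prop :=
  injective iota /\
  forall U : set X, open U <-> exists2 V, open V & iota @^-1` V = U.

Definition proper_compactification {X : topologicalType} {Xhat : uniformType}
    (iota : X -> Xhat) : Prop :=
  [/\ compact [set: Xhat], hausdorff_space Xhat,
      topological_embedding iota & dense (range iota)].

(* The subalgebra of B(X) corresponding to a compactification. *)
Definition extendable {R : realType} {X Xhat : topologicalType}
    (iota : X -> Xhat) : set (X -> R) :=
  [set u | bounded_continuous u /\
           exists2 v : Xhat -> R, continuous v & v \o iota = u].

Definition rel_closure {X Xhat : topologicalType} (iota : X -> Xhat)
    (f : set (X * X)) : set (Xhat * Xhat) :=
  closure [set (iota xy.1, iota xy.2) | xy in f].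

Definition chain_dynamic {X Xhat : uniformType} (iota : X -> Xhat)
    (f : set (X * X)) : Prop :=
  [/\ proper_compactification iota, unif_continuous iota &
      [set xy | chain_rel (rel_closure iota f) (iota xy.1, iota xy.2)]
      = chain_rel f].

Definition proper_map {X Y : topologicalType} (g : X -> Y) : Prop :=
  continuous g /\ forall K : set Y, compact K -> compact (g @^-1` K).

Definition uniform_isomorphism {X Y : uniformType} (g : X -> Y) : Prop :=
  exists h : Y -> X,
    [/\ cancel g h, cancel h g, unif_continuous g & unif_continuous h].

Definition homeomorphism {X Y : topologicalType} (g : X -> Y) : Prop :=
  exists h : Y -> X, [/\ cancel g h, cancel h g, continuous g & continuous h].

Definition cascade {X Xhat : topologicalType} (iota : X -> Xhat)
    (f : set (X * X)) : Prop :=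
  exists2 ghat : Xhat -> Xhat, continuous ghat & rel_closure iota f = graph ghat.

Definition reversible {X Xhat : topologicalType} (iota : X -> Xhat)
    (f : set (X * X)) : Prop :=
  exists2 ghat : Xhat -> Xhat,
    homeomorphism ghat & rel_closure iota f = graph ghat.

(* Main.v *)
(** An elementary Lyapunov function [L] takes the value 0 at [x] or 1 at [z]
    whenever (x, z) is in the chain relation: once [L] is positive along a
    chain, the next application of the relation lifts it to 1 and a small jump
    costs little.  The members of LL extend to such functions for [fhat], so
    chains of [fhat] between points of [X] are controlled by sufficiency of LL.
    Sufficiency says nothing about (x, x), so for chains from [x] to [z] one
    looks at the first step: [fhat x = f x] is compact, so some fixed [y] in
    [f x] satisfies L y <= L z for all [L] in LL, and y = z or (y, z) is in the
    chain relation; in both cases so is (x, z).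

    A chain class of [fhat] is closed, and contains at most one point outside
    [X], because the functions whose extensions agree at two given points form
    a closed subalgebra.  If its trace on [X] is compact and nonempty it has no
    point outside [X]: a chain leading outside must leave a compact
    neighborhood D of the trace, and the jumps out of D accumulate at a point
    [p] of [f D]; all the Lyapunov functions are constant along the class, hence
    also at [p], which puts [p] in the trace, a contradiction. *)
Require Import Defs.
From HB Require Import structures.
From mathcomp Require Import all_boot all_order all_algebra.
From mathcomp Require Import all_classical all_reals all_analysis.
From mathcomp Require Import ring lra.

Set Implicit Arguments.
Unset Strict Implicit.
Unset Printing Implicit Defensive.

Import Order.TTheory GRing.Theory Num.Theory.
Import numFieldNormedType.Exports.

Local Open Scope classical_set_scope.
Local Open Scope ring_scope.

(** * Powers of relations and chain relations *)

Lemma rel_powD (T : Type) (F : set (T * T)) (m n : nat) (x y z : T) :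
  rel_pow F m (x, y) -> rel_pow F n (y, z) -> rel_pow F (m + n) (x, z).
Proof.
move=> Fxy; elim: n z => [|n IHn] z.
  by rewrite addn0 /= /diagonal /= => <-.
by move=> -[w /IHn Fxw Fwz]; rewrite addnS; exists w.
Qed.

Lemma rel_pow_head (T : Type) (F : set (T * T)) (n : nat) (x z : T) :
  rel_pow F n.+1 (x, z) -> exists2 y, F (x, y) & rel_pow F n (y, z).
Proof.
elim: n z => [|n IHn] z.
  by move=> -[y]; rewrite /= /diagonal /= => <- Fxz; exists z.
move=> -[w /IHn[y Fxy Fyw] Fwz]; exists y => //.
by exists w.
Qed.

Lemma rel_pow_homo (T U : Type) (h : T -> U) (F : set (T * T))
    (G : set (U * U)) :
  (forall x y, F (x, y) -> G (h x, h y)) ->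
  forall n x z, rel_pow F n (x, z) -> rel_pow G n (h x, h z).
Proof.
move=> FG; elim=> [|n IHn] x z /=; first by rewrite /diagonal /= => ->.
by move=> -[y /IHn Gxy /FG Gyz]; exists (h y).
Qed.

Lemma sub_rel_pow (T : Type) (F G : set (T * T)) (n : nat) :
  F `<=` G -> rel_pow F n `<=` rel_pow G n.
Proof.
by move=> FG [x z]; apply: (@rel_pow_homo _ _ id) => a b; exact: FG.
Qed.

(** The chain is scanned backwards from [z], so the pair found is its last step out of [D]. *)
Lemma rel_pow_exit (T : Type) (F : set (T * T)) (D : set T) (n : nat)
    (x z : T) : rel_pow F n (x, z) -> D x -> ~ D z ->
  exists a b i j,
    [/\ rel_pow F i (x, a), D a, F (a, b), ~ D b & rel_pow F j (b, z)].
Proof.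
elim: n z => [|n IHn] z /=; first by rewrite /diagonal /= => <-.
move=> -[y Fxy Fyz] Dx Dz; have [Dy|Dy] := pselect (D y).
  by exists y, z, n, 0.
have [a [b [i [j [Fxa Da Fab Db Fby]]]]] := IHn _ Fxy Dx Dy.
by exists a, b, i, j.+1; split=> //; exists y.
Qed.

Lemma chain_rel_trans (X : uniformType) (F : set (X * X)) (x y z : X) :
  chain_rel F (x, y) -> chain_rel F (y, z) -> chain_rel F (x, z).
Proof.
move=> Cxy Cyz V entV; have [m m0 Fxy] := Cxy V entV.
have [n n0 Fyz] := Cyz V entV; exists (m + n)%N; first by rewrite /= addn_gt0 m0.
exact: rel_powD Fxy Fyz.
Qed.

Lemma sub_chain_rel (X : uniformType) (F : set (X * X)) : F `<=` chain_rel F.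
Proof.
move=> -[x y] Fxy V entV; exists 1 => //; exists x => //.
by exists y => //; exact: entourage_refl.
Qed.

Lemma chain_rel_homo (X Y : uniformType) (h : X -> Y) (F : set (X * X))
    (G : set (Y * Y)) : unif_continuous h ->
  (forall x y, F (x, y) -> G (h x, h y)) ->
  forall x z, chain_rel F (x, z) -> chain_rel G (h x, h z).
Proof.
move=> h_uc FG x z Cxz V entV; have [n n0 Fxz] := Cxz _ (h_uc _ entV).
exists n => //; apply: rel_pow_homo Fxz => {n0} a b [c /FG Gac Vcb].
by exists (h c).
Qed.

(** * Elementary Lyapunov functions along chains *)

(** Losses do not accumulate: after a jump [L] exceeds [1 - e], which is nonnegative, so the next
    step of [F] lifts [L] back to 1 before the next jump costs less than [e]. *)
Lemma lyapunov_rel_pow (R : realType) (T : Type) (F V : set (T * T))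
    (L : T -> R) (e : R) (n : nat) (x z : T) : e <= 1 ->
  (forall x y, F (x, y) -> L x = 0 \/ L y = 1) ->
  (forall x y, V (x, y) -> `|L x - L y| < e) ->
  rel_pow (V \; F)%relation n.+1 (x, z) -> L x = 0 \/ 1 - e < L z.
Proof.
move=> e1 LF LV; elim: n z => [|n IHn] z.
  move=> -[y0]; rewrite /= /diagonal /= => <- [y /LF[->|Ly] /LV Lyz].
    by left.
  right.
  by move: Lyz; rewrite Ly ltr_norml => /andP[]; lra.
move=> -[w /IHn[->|Lw] [y /LF[w0|Ly] /LV Lyz]]; [by left|by left| |right].
  by rewrite w0 in Lw; lra.
by move: Lyz; rewrite Ly ltr_norml => /andP[]; lra.
Qed.

(** The initial jump and the later ones together cost only one [e]: either [L x = 0] and then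
    [L y < e], or [L z > 1 - e] while [L y] is at most 1. *)
Lemma lyapunov_after_jump (R : realType) (T : Type) (F V : set (T * T))
    (L : T -> R) (e : R) (n : nat) (y x z : T) : 0 < e <= 1 ->
  (forall x, 0 <= L x <= 1) ->
  (forall x y, F (x, y) -> L x = 0 \/ L y = 1) ->
  (forall x y, V (x, y) -> `|L x - L y| < e) ->
  V (y, x) -> rel_pow (V \; F)%relation n (x, z) -> L y < L z + e.
Proof.
move=> /andP[e0 e1] L01 LF LV /LV; rewrite ltr_norml => /andP[Lyx Lyx'].
case: n => [|n]; first by rewrite /= /diagonal /= => <-; lra.
case/(lyapunov_rel_pow e1 LF LV) => [x0|Lz].
  by have := L01 z; rewrite x0 in Lyx'; lra.
by have := L01 y; lra.
Qed.

(** A chain that ends with a step of [F] and no jump loses nothing: if [L x] is nonzero, then [L a]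
    is positive and [L b = 1]. *)
Lemma lyapunov_before_step (R : realType) (T : Type) (F V : set (T * T))
    (L : T -> R) (e : R) (n : nat) (x a b : T) : e <= 1 ->
  (forall x, 0 <= L x <= 1) ->
  (forall x y, F (x, y) -> L x = 0 \/ L y = 1) ->
  (forall x y, V (x, y) -> `|L x - L y| < e) ->
  rel_pow (V \; F)%relation n (x, a) -> F (a, b) -> L x <= L b.
Proof.
move=> e1 L01 LF LV + /LF; have := L01 b; have := L01 x.
case: n => [|n] xb Lb; first by rewrite /= /diagonal /= => <- [->|->]; lra.
by case/(lyapunov_rel_pow e1 LF LV) => [->|La] [a0|->]; lra.
Qed.

Lemma unif_continuousR (R : realType) (X : uniformType) (u : X -> R) :
  unif_continuous u <->
  forall e, 0 < e -> entourage [set xy | `|u xy.1 - u xy.2| < e].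
Proof.
split=> [u_uc e e0|u_uc V].
  apply: (u_uc [set xy | ball xy.1 e xy.2]).
  exact: (entourage_ball _ (PosNum e0)).
rewrite -entourage_ballE => -[e /= e0 eV].
by apply: filterS (u_uc e e0) => -[x y] /= xy; exact: eV.
Qed.

Lemma elementary_lyapunov_chain_rel (R : realType) (X : uniformType)
    (F : set (X * X)) (L : X -> R) :
  elementary_lyapunov F L -> elementary_lyapunov (chain_rel F) L.
Proof.
move=> [L_uc L01 LF]; split=> // x z Cxz.
have [Lx0|Lx0] := eqVneq (L x) 0; [by left|right].
apply/eqP; rewrite eq_le; have /andP[_ ->] := L01 z; rewrite /= leNgt.
(* With this [e], [1 - e] equals [L z], so the bound along a chain becomes [L z < L z]. *)
apply/negP => Lz1; pose e := 1 - L z.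
have e0 : 0 < e by rewrite /e; lra.
have e1 : e <= 1 by rewrite /e; have := L01 z; lra.
have [[//|n] _] := Cxz _ ((unif_continuousR L).1 L_uc e e0).
case/(lyapunov_rel_pow e1 LF) => [//|/eqP|]; first by rewrite (negbTE Lx0).
by rewrite /e; lra.
Qed.

Lemma chain_le (R : realType) (X : uniformType) (F : set (X * X)) (L : X -> R)
    (x z : X) : elementary_lyapunov F L -> chain_rel F (x, z) -> L x <= L z.
Proof.
move=> /elementary_lyapunov_chain_rel[_ L01 LF] /LF.
by have := L01 x; have := L01 z; move=> ? ? [->|->]; lra.
Qed.

(** * Compactness, closed relations and closedness of chain relations *)

(** Entourages that work locally are replaced by a single one, since [P] only improves when the
    entourage shrinks. The filter [small] expresses [for all sufficiently small entourages], which
    puts the claim in near-covering form. *)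
Lemma entourage_near_covering (S : topologicalType) (T : uniformType)
    (K : set S) (P : set (T * T) -> S -> Prop) : compact K ->
  (forall V W x, W `<=` V -> P V x -> P W x) ->
  (forall x, K x -> exists2 V, entourage V & nbhs x (P V)) ->
  exists2 V, entourage V & K `<=` P V.
Proof.
move=> /compact_near_coveringP cK antiP KP.
pose small : set_system (set (T * T)) := filter_from (@entourage T)
  (fun V => [set W | entourage W /\ W `<=` V]).
have smallF : Filter small.
  apply: filter_from_filter; first by exists setT; exact: entourageT.
  move=> V W entV entW; exists (V `&` W); first exact: filterI.
  by move=> U [entU]; rewrite subsetI => -[UV UW].
have smallP x : K x -> \forall x' \near x & W \near small, P W x'.
  move=> /KP[V entV PV]; exists (P V, [set W | entourage W /\ W `<=` V]) => /=.
    by split=> //; exists V.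
  by move=> [y W] /= [PVy [_ WV]]; exact: antiP PVy.
have [V entV VP] := cK _ small P smallF smallP.
by exists V => //; apply: (VP V); split.
Qed.

(** Upper semicontinuity. Each [y'] has a neighborhood that settles the claim for [q] near [p]: a
    [V]-ball if [y'] is in the image of [p], otherwise a factor of a box around [(p, y')] that
    misses [F]. Compactness makes the neighborhood of [p] uniform. *)
Lemma closed_rel_usc (T : uniformType) (F V : set (T * T)) (p : T) :
  compact [set: T] -> closed F -> entourage V ->
  \forall q \near p, forall y', F (q, y') -> exists2 y, F (p, y) & V (y, y').
Proof.
move=> /compact_near_coveringP cT cF entV.
suff : \forall q \near p, [set: T] `<=`
    [set y' | F (q, y') -> exists2 y, F (p, y) & V (y, y')].
  by apply: filterS => q H y' Fqy'; exact: (H y').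
apply: (cT _ (nbhs p) (fun q => [set y' | F (q, y') ->
  exists2 y, F (p, y) & V (y, y')])) => y _.
have [Fpy|Fpy] := pselect (F (p, y)).
  exists (xsection V y, setT) => /=.
    by split; [exact: nbhs_entourage|exact: filterT].
  by move=> [y' q] /= [/xsectionP Vyy' _] _; exists y.
have : nbhs (p, y) (~` F) by apply: open_nbhs_nbhs; split=> //; exact: closed_openC.
case=> -[A B] /= [nA nB] ABF; exists (B, A) => //= -[y' q] /= [By' Aq] Fqy'.
by case: (ABF (q, y')).
Qed.

(** Chains end with a jump, so a small displacement of the endpoint is absorbed in the last jump. *)
Lemma closed_chain_rel_image (X : uniformType) (F : set (X * X)) (x : X) :
  closed [set z | chain_rel F (x, z)].
Proof.
move=> z clz V entV; have entW := entourage_split_ent entV.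
have [y [Cxy /xsectionP Wzy]] :=
  clz _ (nbhs_entourage z (entourage_inv entW)).
have [[//|n] _ [w Fxw [u Fwu Wuy]]] := Cxy _ entW.
exists n.+1 => //; exists w; last first.
  by exists u => //; exact: entourage_split entV Wuy Wzy.
apply: (sub_rel_pow _ Fxw); apply: set_compose_subset => //.
exact: split_ent_subset.
Qed.

(** Chains begin with a step of [F], so no jump absorbs a displacement of the starting point. Upper
    semicontinuity replaces the first step from [y] by one from [x] with a nearby value, and the
    first jump takes up the difference. *)
Lemma closed_chain_rel_preimage (X : uniformType) (F : set (X * X)) (z : X) :
  compact [set: X] -> closed F -> closed [set x | chain_rel F (x, z)].
Proof.
move=> cX cF x clx V entV; have entW := entourage_split_ent entV.
have [y [Cyz yx]] := clx _ (closed_rel_usc x cX cF entW).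
have [n n0 Fyz] := Cyz _ entW.
case: n n0 Fyz => [//|n] _ Fyz.
have [w [u Fyu Wuw] Fwz] := rel_pow_head Fyz.
have [u' Fxu' Wu'u] := yx _ Fyu.
exists (1 + n)%N => //; apply: (@rel_powD _ _ _ _ _ w).
  by exists x => //; exists u' => //; exact: entourage_split entV Wu'u Wuw.
apply: (sub_rel_pow _ Fwz); apply: set_compose_subset => //.
exact: split_ent_subset.
Qed.

(** * Chain classes *)

(** Transitivity allows any point of a class as base point and makes the cyclicity condition
    automatic. *)
Lemma chain_classP (X : uniformType) (F : set (X * X)) (E : set X) (x : X) :
  chain_class F E -> E x ->
  E = [set y | chain_rel F (x, y) /\ chain_rel F (y, x)].
Proof.
move=> [x0 Cx0 ->] [/= Cx [Cx0x Cxx0]]; apply/seteqP; split=> y /=.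
  move=> [_ [Cx0y Cyx0]]; split; first exact: chain_rel_trans Cxx0 Cx0y.
  exact: chain_rel_trans Cyx0 Cx0x.
move=> [Cxy Cyx]; split; first exact: chain_rel_trans Cyx Cxy.
by split; [exact: chain_rel_trans Cx0x Cxy|exact: chain_rel_trans Cyx Cxx0].
Qed.

Lemma chain_class_nonempty (X : uniformType) (F : set (X * X)) (E : set X) :
  chain_class F E -> E !=set0.
Proof. by move=> [x Cx ->]; exists x. Qed.

Lemma closed_chain_class (X : uniformType) (F : set (X * X)) (E : set X) :
  compact [set: X] -> closed F -> chain_class F E -> closed E.
Proof.
move=> cX cF cE; have [x Ex] := chain_class_nonempty cE.
rewrite (chain_classP cE Ex); apply: closedI; first exact: closed_chain_rel_image.
exact: closed_chain_rel_preimage.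
Qed.

(** * Separation by continuous functions and algebras of bounded functions *)

Lemma exists_separating_function (R : realType) (T : topologicalType)
    (A B : set T) : compact [set: T] -> hausdorff_space T ->
  closed A -> closed B -> A `&` B = set0 ->
  exists v : T -> R, [/\ continuous v, forall x, 0 <= v x <= 1,
    forall x, A x -> v x = 0 & forall x, B x -> v x = 1].
Proof.
move=> cT hT clA clB AB0.
have /normal_separatorP sepT := compact_normal hT cT.
have /(@uniform_separatorP _ R)[v [v_cont v01 vA vB]] := sepT R _ _ clA clB AB0.
exists v; split=> // [x|x Ax|x Bx].
- by have /= := v01 (v x) (ex_intro2 _ _ x I erefl); rewrite in_itv.
- by apply: vA; exists x.
- by apply: vB; exists x.
Qed.

Lemma eq_of_continuous (R : realType) (T : topologicalType) (x y : T) :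
  compact [set: T] -> hausdorff_space T ->
  (forall v : T -> R, continuous v -> v x = v y) -> x = y.
Proof.
move=> cT hT vxy; apply: contrapT => xy.
have cl1 : forall z : T, closed [set z].
  exact/accessible_closed_set1/hausdorff_accessible.
have [|||v [v_cont _ v0 v1]] :=
  @exists_separating_function R _ [set x] [set y] cT hT;
  [exact: cl1|exact: cl1| |].
  by rewrite -subset0 => z /= [-> /xy].
by have := vxy _ v_cont; rewrite v0 // v1 // => /eqP; rewrite eq_sym oner_eq0.
Qed.

Lemma boundedR (R : realType) (T : Type) (u : T -> R) :
  [bounded u x | x in [set: T]] <-> exists M, forall x, `|u x| <= M.
Proof.
split=> [/pinfty_ex_gt0[M _ uM]|[M uM]]; first by exists M => x; exact: uM.
exists M; split; first exact: num_real.
by move=> N MN x _ /=; rewrite (le_trans (uM x))// ltW.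
Qed.

Lemma bounded_continuous_comp (R : realType) (X Y : topologicalType)
    (h : X -> Y) (u : Y -> R) : continuous h ->
  bounded_continuous u -> bounded_continuous (u \o h).
Proof.
move=> h_cont [u_cont /boundedR[M uM]]; split.
  by move=> x; apply: continuous_comp; [exact: h_cont|exact: u_cont].
by apply/boundedR; exists M => x; exact: uM.
Qed.

Lemma unif_continuous_continuous (X Y : uniformType) (h : X -> Y) :
  unif_continuous h -> continuous h.
Proof.
move=> h_uc x; apply/cvg_app_entourageP => V entV.
have entU : entourage [set xy | V (h xy.1, h xy.2)] := h_uc _ entV.
by apply: filterS (nbhs_entourage x entU) => y /xsectionP.
Qed.

Lemma closed_subalgebra_bounded_unif_continuous (R : realType)
    (X : uniformType) :
  closed_subalgebra (@bounded_unif_continuous R X).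
Proof.
split.
- by move=> u [u_uc u_b]; split=> //; exact: unif_continuous_continuous.
- move=> c; split; last by apply/boundedR; exists `|c|.
  apply/unif_continuousR => e e0; apply: filterS (@entourageT X) => xy _ /=.
  by rewrite subrr normr0.
- move=> u v [/unif_continuousR u_uc /boundedR[M uM]].
  move=> [/unif_continuousR v_uc /boundedR[N vN]]; split; last first.
    apply/boundedR; exists (M + N) => x; rewrite (le_trans (ler_normD _ _))//.
    exact: lerD.
  apply/unif_continuousR => e e0; have e2 : 0 < e / 2 by lra.
  apply: filterS2 (u_uc _ e2) (v_uc _ e2) => -[x y] /=.
  by rewrite !ltr_norml => /andP[? ?] /andP[? ?]; apply/andP; split; lra.
- move=> u v [/unif_continuousR u_uc /boundedR[M uM]].
  move=> [/unif_continuousR v_uc /boundedR[N vN]]; split; last first.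
    by apply/boundedR; exists (M * N) => x; rewrite normrM ler_pM.
  (* The summand 1 keeps the denominator positive and leaves [|M| * d + d * |N|] strictly below [e].
     Absolute values are taken because [M] and [N] may be negative if [X] is empty. *)
  apply/unif_continuousR => e e0; pose d := e / (`|M| + `|N| + 1).
  have MN0 : 0 < `|M| + `|N| + 1 by have := normr_ge0 M; have := normr_ge0 N; lra.
  have d0 : 0 < d by rewrite divr_gt0.
  apply: filterS2 (u_uc _ d0) (v_uc _ d0) => -[x y] /= uxy vxy.
  have -> : u x * v x - u y * v y = u x * (v x - v y) + (u x - u y) * v y by ring.
  rewrite (le_lt_trans (ler_normD _ _))// !normrM.
  have : `|u x| * `|v x - v y| <= `|M| * d.
    by apply: ler_pM => //; [exact: le_trans (uM x) (ler_norm M)|exact: ltW].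
  have : `|u x - u y| * `|v y| <= d * `|N|.
    by apply: ler_pM => //; [exact: ltW|exact: le_trans (vN y) (ler_norm N)].
  have : d * (`|M| + `|N| + 1) = e by rewrite /d divfK// gt_eqF.
  by lra.
- move=> u [u_cont u_b] uA; split=> //; apply/unif_continuousR => e e0.
  have e3 : 0 < e / 3 by lra.
  have [v [/unif_continuousR v_uc _] uv] := uA _ e3.
  apply: filterS (v_uc _ e3) => -[x y] /=; have := uv x; have := uv y.
  rewrite !ler_norml !ltr_norml => /andP[? ?] /andP[? ?] /andP[? ?].
  by apply/andP; split; lra.
Qed.

(** The algebra [A] ensures that the intersection is over a nonempty family; an empty one would give
    all functions, including unbounded ones. *)
Lemma closed_subalgebra_generated (R : realType) (X : topologicalType)
    (S A : set (X -> R)) : closed_subalgebra A -> S `<=` A ->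
  closed_subalgebra (generated_closed_subalgebra S).
Proof.
move=> clA SA; split.
- by move=> u Su; have [+ _ _ _ _] := clA; apply; exact: Su.
- by move=> c B [[]].
- by move=> u v Su Sv B BS; have [[_ _ + _ _] _] := BS; apply; [exact: Su|exact: Sv].
- by move=> u v Su Sv B BS; have [[_ _ _ + _] _] := BS; apply; [exact: Su|exact: Sv].
- move=> u u_bc uS B BS; have [[_ _ _ _ +] _] := BS; apply=> // e /uS[v Sv uv].
  by exists v => //; exact: Sv.
Qed.

Lemma sub_generated_closed_subalgebra (R : realType) (X : topologicalType)
    (S : set (X -> R)) : S `<=` generated_closed_subalgebra S.
Proof. by move=> u Su B [_]; exact. Qed.

Lemma compactly_supported_unif_continuous (R : realType) (X : uniformType) :
  @compactly_supported R X `<=` bounded_unif_continuous.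
Proof.
move=> u [u_cont u_supp].
have u0 x : ~ closure [set x | u x != 0] x -> u x = 0.
  by move=> ux; apply: contrapT => /eqP ux0; apply: ux; exact: subset_closure.
split; last first.
  apply/boundedR.
  have : compact (u @` closure [set x | u x != 0]).
    by apply: continuous_compact => //; exact: continuous_subspaceT.
  move=> /compact_bounded /pinfty_ex_gt0[M M0 uM]; exists M => x.
  have [Kx|/u0 ->] := pselect (closure [set x | u x != 0] x).
    by apply: uM; exists x.
  by rewrite normr0 ltW.
apply/unif_continuousR => e e0.
pose P (V : set (X * X)) x := forall y, V (x, y) -> `|u x - u y| < e.
have [|x Kx|V entV VP] := @entourage_near_covering X X _ P u_supp.
- by move=> V W x WV PV y /WV; exact: PV.
- have e2 : 0 < e / 2 by lra.
  have /cvgrPdist_lt /(_ _ e2) /nbhsP[V entV VP] := u_cont x.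
  exists (split_ent V).
    exact: entourage_split_ent entV.
  apply: filterS (nbhs_entourage x (entourage_split_ent entV)).
  move=> y /xsectionP Vxy z Vyz.
  have : `|u x - u z| < e / 2.
    by apply: VP; apply/xsectionP; exact: entourage_split entV Vxy Vyz.
  have : `|u x - u y| < e / 2.
    by apply: VP; apply/xsectionP; exact: split_ent_subset Vxy.
  by rewrite !ltr_norml => /andP[? ?] /andP[? ?]; apply/andP; split; lra.
(* [V] controls pairs whose first point is in the support. Intersecting with its inverse also covers
   those whose second point is there; on all other pairs [u] vanishes twice. *)
apply: filterS (filterI entV (entourage_inv entV)) => -[x y] [/= Vxy Vyx].
have [/VP/(_ y Vxy)//|/u0 ux] := pselect (closure [set x | u x != 0] x).
have [/VP/(_ x Vyx)|/u0 uy] := pselect (closure [set x | u x != 0] y).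
  by rewrite distrC.
by rewrite ux uy subrr normr0.
Qed.

(** * Compactifications and extension of relations and functions *)

Lemma topological_embedding_continuous (X Y : topologicalType) (iota : X -> Y) :
  topological_embedding iota -> continuous iota.
Proof. by move=> [_ iotaP]; apply/continuousP => V oV; apply/iotaP; exists V. Qed.

Lemma topological_embedding_nbhs (X Y : topologicalType) (iota : X -> Y)
    (x : X) (A : set X) : topological_embedding iota -> nbhs x A ->
  exists2 B, open_nbhs (iota x) B & iota @^-1` B `<=` A.
Proof.
move=> [_ iotaP]; rewrite nbhsE => -[U [/iotaP[B oB <-] Bx] UA].
by exists B.
Qed.

Lemma dense_closed_subset (T : topologicalType) (D A : set T) :
  dense D -> closed A -> D `<=` A -> forall z, A z.
Proof.
move=> dD clA DA z; apply: contrapT => Az.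
have [|w [nAw /DA Aw]] := dD (~` A) _ (closed_openC clA); first by exists z.
exact: nAw.
Qed.

Lemma closed_eqR (R : realType) (T : topologicalType) (u v : T -> R) :
  continuous u -> continuous v -> closed [set x | u x = v x].
Proof.
move=> u_cont v_cont.
rewrite (_ : [set x | u x = v x] = (u \- v) @^-1` [set 0]).
  apply: closed_comp; last exact/accessible_closed_set1/hausdorff_accessible/Rhausdorff.
  by move=> x _; apply: continuousB; [exact: u_cont|exact: v_cont].
by apply/seteqP; split=> x /= => [->|/eqP]; rewrite ?subrr// subr_eq0 => /eqP.
Qed.

Lemma closed_leR (R : realType) (T : topologicalType) (u v : T -> R) :
  continuous u -> continuous v -> closed [set x | u x <= v x].
Proof.
move=> u_cont v_cont.
rewrite (_ : [set x | u x <= v x] = (u \- v) @^-1` [set t | t <= 0]).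
  apply: closed_comp; last exact: closed_le.
  by move=> x _; apply: continuousB; [exact: u_cont|exact: v_cont].
by apply/seteqP; split=> x /=; rewrite subr_le0.
Qed.

(** Let [B] be open in [Xhat] with trace inside [K]. The image of [K] is closed, so a point of [B]
    outside it would have a neighborhood within [B] missing that image, and by density a point of
    [X] in it, which is absurd. *)
Lemma nbhs_compactification_image (X : topologicalType) (Xhat : uniformType)
    (iota : X -> Xhat) (K : set X) (x : X) :
  proper_compactification iota -> compact K -> nbhs x K ->
  nbhs (iota x) (iota @` K).
Proof.
move=> [_ hXhat emb dX] cK xK.
have [B [oB Bx] BK] := topological_embedding_nbhs emb xK.
rewrite nbhsE; exists B => // z Bz.
have clK : closed (iota @` K).
  apply: compact_closed => //; apply: continuous_compact => //.
  exact/continuous_subspaceT/topological_embedding_continuous.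
apply: contrapT => Kz.
have [|t [[Bt Kt] [w _ wt]]] :=
  dX (B `&` ~` (iota @` K)) _ (openI oB (closed_openC clK)).
  by exists z.
by apply: Kt; exists w => //; apply: BK; rewrite /= wt.
Qed.

Lemma locally_compact_nbhs (X : topologicalType) (x : X) :
  locally_compact [set: X] -> exists2 K, nbhs x K & compact K.
Proof.
move=> /(_ x I)[K xK [cK _]]; exists K => //.
have : nbhs x [set y | [set: X] y -> K y] := xK.
by apply: filterS => y; exact.
Qed.

Lemma open_range_compactification (X : topologicalType) (Xhat : uniformType)
    (iota : X -> Xhat) : locally_compact [set: X] ->
  proper_compactification iota -> open (range iota).
Proof.
move=> lX cpt; rewrite openE => _ [x _ <-].
have [K xK cK] := locally_compact_nbhs x lX.
by apply: filterS (nbhs_compactification_image cpt cK xK) => _ [y _ <-]; exists y.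
Qed.

(** Taking the closure adds no pair above a point of [X]. Near [iota x] first coordinates lie in a
    compact [K], so second coordinates lie in the image of the compact set [rel_image f K], which is
    closed and therefore contains [w]; then [f] closed gives the pair. *)
Lemma rel_closure_at_interior (X : topologicalType) (Xhat : uniformType)
    (iota : X -> Xhat) (f : set (X * X)) (x : X) (w : Xhat) :
  locally_compact [set: X] -> proper_compactification iota -> plus_proper f ->
  rel_closure iota f (iota x, w) -> exists2 y, f (x, y) & iota y = w.
Proof.
move=> lX cpt [clf fK] fxw; have [_ hXhat emb _] := cpt.
have [K xK cK] := locally_compact_nbhs x lX.
have [y _ yw] : (iota @` rel_image f K) w.
  have : closed (iota @` rel_image f K).
    apply: compact_closed => //; apply: continuous_compact; last exact: fK.
    exact/continuous_subspaceT/topological_embedding_continuous.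
  apply => B wB.
  have /fxw[_ [[[a b] fab <-] [[a' Ka' a'E] Bb]]] :
      nbhs (iota x, w) ((iota @` K) `*` B).
    exists (iota @` K, B) => //; split=> //=.
    exact: nbhs_compactification_image.
  exists (iota b); split=> //; exists b => //; exists a => //.
  by move: a'E => /= /emb.1 <-.
exists y => //; apply: clf => U -[[A B] [/= xA yB] ABU].
have [A' [oA' A'x] A'A] := topological_embedding_nbhs emb xA.
have [B' [oB' B'y] B'B] := topological_embedding_nbhs emb yB.
have /fxw[_ [[[a b] fab <-] [/= A'a B'b]]] : nbhs (iota x, w) (A' `*` B').
  exists (A', B') => //; split; apply: open_nbhs_nbhs; split=> //=.
  by rewrite -yw.
by exists (a, b); split=> //; apply: ABU; split; [exact: A'A|exact: B'B].
Qed.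

Lemma rel_closure_subset (X Xhat : topologicalType) (iota : X -> Xhat)
    (f : set (X * X)) (C : set (Xhat * Xhat)) : closed C ->
  (forall x y, f (x, y) -> C (iota x, iota y)) -> rel_closure iota f `<=` C.
Proof.
move=> clC fC; rewrite /rel_closure; apply: (subset_trans (closureS _)).
  by move=> _ [[x y] fxy <-]; exact: fC fxy.
by rewrite -(closure_id C).1.
Qed.

(** The bounds and the alternative [0 or 1] are closed conditions, so they pass from [X] and [f] to
    their closures; uniform continuity comes from compactness. *)
Lemma elementary_lyapunov_rel_closure (R : realType) (X Xhat : uniformType)
    (iota : X -> Xhat) (f : set (X * X)) (L : X -> R) (Lhat : Xhat -> R) :
  proper_compactification iota -> elementary_lyapunov f L ->
  continuous Lhat -> Lhat \o iota = L ->
  elementary_lyapunov (rel_closure iota f) Lhat.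
Proof.
move=> [cXhat hXhat emb dX] [_ L01 Lf] Lhat_cont LE.
have cst_cont (S : topologicalType) c : continuous (cst c : S -> R).
  by move=> x; exact: cvg_cst.
split.
- apply/unif_continuousR => e e0; rewrite compact_entourageE// => x.
  have e2 : 0 < e / 2 by lra.
  have /cvgrPdist_lt /(_ _ e2) xe := Lhat_cont x.
  exists ([set y | `|Lhat x - Lhat y| < e / 2],
          [set y | `|Lhat x - Lhat y| < e / 2]) => //.
  move=> [y z] [/=]; rewrite !ltr_norml => /andP[? ?] /andP[? ?].
  by apply/andP; split; lra.
- apply: (@dense_closed_subset _ _ [set z | 0 <= Lhat z <= 1] dX).
    rewrite (_ : [set _ | _] =
      [set z | cst 0 z <= Lhat z] `&` [set z | Lhat z <= cst 1 z]).
      by apply: closedI; apply: closed_leR.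
    by apply/seteqP; split=> z /=; move/andP.
  by move=> _ [x _ <-]; have := L01 x; rewrite -LE.
- move=> x y fxy.
  suff : ([set xy | Lhat xy.1 = 0] `|` [set xy | Lhat xy.2 = 1]) (x, y) by [].
  apply: rel_closure_subset fxy => //.
    have fst_cont : continuous (Lhat \o fst : Xhat * Xhat -> R).
      by move=> z; apply: continuous_comp; [exact: cvg_fst|exact: Lhat_cont].
    have snd_cont : continuous (Lhat \o snd : Xhat * Xhat -> R).
      by move=> z; apply: continuous_comp; [exact: cvg_snd|exact: Lhat_cont].
    exact: closedU (closed_eqR fst_cont (cst_cont _ 0))
                   (closed_eqR snd_cont (cst_cont _ 1)).
  by move=> a b /Lf; rewrite -LE.
Qed.

(** The covering runs over points of the compact [Xhat], the entourages over [X]. Near each [z], a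
    function separating [z] from the complement of a small neighborhood gives the entourage. *)
Lemma unif_continuous_compactification (R : realType) (X Xhat : uniformType)
    (iota : X -> Xhat) : compact [set: Xhat] -> hausdorff_space Xhat ->
  (forall v : Xhat -> R, continuous v -> unif_continuous (v \o iota)) ->
  unif_continuous iota.
Proof.
move=> cXhat hXhat iota_uc V entV.
pose P (E : set (X * X)) z :=
  forall x y, iota x = z -> E (x, y) -> V (iota x, iota y).
have [|z _|E entE EP] := @entourage_near_covering Xhat X _ P cXhat.
- by move=> E F x FE PE a b ax /FE; exact: PE.
- have entW := entourage_invI (entourage_split_ent entV).
  have [oW Wz] := open_nbhs_entourage z entW.
  set W := interior _ in oW Wz.
  have inW y : W y -> split_ent V (z, y) /\ split_ent V (y, z).
    by move=> /interior_subset /xsectionP[].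
  have cl1 : closed [set z] by exact/accessible_closed_set1/hausdorff_accessible.
  have zW0 : [set z] `&` ~` W = set0 by rewrite -subset0 => y /= [-> ].
  have [v [v_cont v01 v0 v1]] :=
    @exists_separating_function R _ _ _ cXhat hXhat cl1 (open_closedC oW) zW0.
  have vW y : v y < 1 -> W y.
    by move=> vy; apply: contrapT => /v1 vy1; rewrite vy1 ltxx in vy.
  have h0 : 0 < (2^-1 : R) by lra.
  (* If [iota x] is close to [z], then [v] is below 1/2 there; a further variation below 1/2 keeps
     [v (iota y)] below 1, so both points are in [W]. *)
  exists [set xy | `|(v \o iota) xy.1 - (v \o iota) xy.2| < 2^-1].
    exact: ((unif_continuousR _).1 (iota_uc _ v_cont)).
  have /cvgrPdist_lt /(_ _ h0) := v_cont z.
  apply: filterS => a + x y xa /=; rewrite (v0 z) // -xa !ltr_norml.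
  move=> /andP[? ?] /andP[? ?].
  have [_ Vxz] : split_ent V (z, iota x) /\ split_ent V (iota x, z).
    by apply/inW/vW; lra.
  have [Vzy _] : split_ent V (z, iota y) /\ split_ent V (iota y, z).
    by apply/inW/vW; lra.
  exact: entourage_split entV Vxz Vzy.
by apply: filterS entE => -[x y] Exy; exact: (EP (iota x)).
Qed.

(** * Chains of a closed relation on a compact space *)

Lemma compact_rel_image (T : topologicalType) (F : set (T * T)) (D : set T) :
  compact [set: T] -> closed F -> closed D -> compact (rel_image F D).
Proof.
move=> cT cF cD.
rewrite (_ : rel_image F D = snd @` (F `&` (fst @^-1` D))).
  apply: continuous_compact.
    by apply: continuous_subspaceT => z; exact: cvg_snd.
  have cTT : compact [set: T * T] by rewrite -setXTT; exact: compact_setX.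
  apply: (subclosed_compact _ cTT) => //; apply: closedI => //.
  by apply: closed_comp => // z _; exact: cvg_fst.
apply/seteqP; split=> [y [x Dx Fxy]|_ [[x y] [Fxy Dx] <-]]; last by exists x.
by exists (x, y).
Qed.

Lemma lyapunov_no_descent (R : realType) (T : uniformType) (F : set (T * T))
    (v : T -> R) (p z : T) : elementary_lyapunov F v -> v z < v p ->
  exists2 V, entourage V & \forall q \near p, forall W n c, W `<=` V ->
    W (q, c) -> ~ rel_pow (W \; F)%relation n (c, z).
Proof.
(* Half of the drop from [p] to [z] is allowed for passing from [p] to [q], the other half for the
   jump. *)
move=> [v_uc v01 vF] vzp; pose e := (v p - v z) / 2.
have e0 : 0 < e by rewrite /e; lra.
have e1 : e <= 1 by rewrite /e; have := v01 p; have := v01 z; lra.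
exists [set xy | `|v xy.1 - v xy.2| < e]; first exact: ((unif_continuousR v).1 v_uc).
have v_cont := unif_continuous_continuous v_uc.
have /cvgrPdist_lt /(_ _ e0) := v_cont p.
apply: filterS => q; rewrite ltr_norml => /andP[_ pq] W n c WV Wqc Wcz.
have : v q < v z + e.
  apply: (@lyapunov_after_jump _ _ F W v e n q c z) => //.
    by rewrite e0.
  by move=> x y /WV.
by move: pq; rewrite /e; lra.
Qed.

(** Otherwise each [y] in the image of [x] has some [v] with [v z < v y], which forbids fine chains
    from near [y] to [z]. That image is compact, so one entourage forbids them for all [y], hence
    every chain from [x] to [z]. *)
Lemma chain_rel_first_step (R : realType) (T : uniformType) (F : set (T * T))
    (LL : set (T -> R)) (x z : T) : compact [set: T] -> closed F ->
  (forall v, LL v -> elementary_lyapunov F v) -> chain_rel F (x, z) ->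
  exists2 y, F (x, y) & forall v, LL v -> v y <= v z.
Proof.
move=> cT cF lyap Cxz; apply: contrapT => noy.
pose P V y := forall n c, V (y, c) -> ~ rel_pow (V \; F)%relation n (c, z).
have antiP V W y : W `<=` V -> P V y -> P W y.
  move=> WV PV n c /WV Vyc /(sub_rel_pow (set_compose_subset WV (@subset_refl _ _))).
  exact: PV Vyc.
have cFx : compact [set y | F (x, y)].
  apply: (subclosed_compact _ cT) => //.
  apply: (@closed_comp _ _ (fun y => (x, y)) F) => // y _.
  by apply: cvg_pair => //; exact: cvg_cst.
have [|V entV VP] := entourage_near_covering cFx antiP.
  move=> y Fxy; have [v LLv vzy] : exists2 v, LL v & v z < v y.
    apply: contrapT => nov; apply: noy; exists y => // v LLv.
    by rewrite leNgt; apply/negP => vzy; apply: nov; exists v.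
  have [V entV nearV] := lyapunov_no_descent (lyap v LLv) vzy.
  by exists V => //; apply: filterS nearV => q Vq n c; exact: Vq.
have [n n0 Vxz] := Cxz _ entV; case: n n0 Vxz => [//|n] _ Vxz.
have [c [y Fxy Vyc] Vcz] := rel_pow_head Vxz.
exact: (VP y Fxy n c).
Qed.

(** Fine chains leave [D] by a step to some [p] in the compact image of [D] and a jump out. Such an
    exit is impossible near [p] in each of three cases: [p] is not in the closure of the complement
    of [D], so the jump stays in [D]; [v z < v p], so the chain cannot go on to [z]; [v p < v x], so
    it cannot reach [p]. *)
Lemma chain_rel_exit (R : realType) (T : uniformType) (F : set (T * T))
    (LL : set (T -> R)) (D : set T) (x z : T) : compact [set: T] -> closed F ->
  (forall v, LL v -> elementary_lyapunov F v) -> closed D ->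
  chain_rel F (x, z) -> D x -> ~ D z ->
  exists a p, [/\ D a, F (a, p), closure (~` D) p &
    forall v, LL v -> v x <= v p <= v z].
Proof.
move=> cT cF lyap cD Cxz Dx Dz; apply: contrapT => nop.
pose P V p := forall a c i j, F (a, p) -> V (p, c) -> ~ D c ->
  rel_pow (V \; F)%relation i (x, a) -> ~ rel_pow (V \; F)%relation j (c, z).
have subF (V W : set (T * T)) :
    W `<=` V -> (W \; F)%relation `<=` (V \; F)%relation.
  by move=> WV; exact: set_compose_subset.
have [V W p WV PV|p [a Da Fap]|V entV VP] :=
    entourage_near_covering (P := P) (compact_rel_image cT cF cD).
- move=> a c i j Fap /WV Vpc Dc /(sub_rel_pow (subF _ _ WV)) Vxa.
  by move=> /(sub_rel_pow (subF _ _ WV)); exact: PV Vpc Dc Vxa.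
- have [Dp|] := pselect (closure (~` D) p); last first.
    move=> /existsNP[B] /not_implyP[/nbhsP[V entV VB]] DB.
    exists (split_ent V); first exact: entourage_split_ent.
    apply: filterS (nbhs_entourage p (entourage_split_ent entV)).
    move=> q /xsectionP Vpq b c i j _ Vqc Dc _ _; apply: DB; exists c; split=> //.
    by apply/VB/xsectionP; exact: entourage_split entV Vpq Vqc.
  have [v LLv vxpz] : exists2 v, LL v & ~ (v x <= v p <= v z).
    apply: contrapT => nov; apply: nop; exists a, p; split=> // v LLv.
    by apply: contrapT => vxpz; apply: nov; exists v.
  have [vzp|vpz] := ltP (v z) (v p).
    have [V entV nearV] := lyapunov_no_descent (lyap v LLv) vzp.
    exists V => //; apply: filterS nearV => q Vq b c i j _ Vqc _ _.
    exact: Vq Vqc.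
  have vpx : v p < v x.
    by rewrite ltNge; apply/negP => vxp; apply: vxpz; rewrite vxp.
  have [v_uc v01 vF] := lyap v LLv.
  (* Tolerance 1 is enough, because a chain ending with an exact step does not lower [v]. *)
  exists [set xy | `|v xy.1 - v xy.2| < 1]; first exact: ((unif_continuousR v).1 v_uc).
  have xp0 : 0 < v x - v p by lra.
  have v_cont := unif_continuous_continuous v_uc.
  have /cvgrPdist_lt /(_ _ xp0) := v_cont p.
  apply: filterS => q; rewrite ltr_norml => /andP[vpq _].
  move=> b c i j Fbq _ _ Vxb _.
  by have := lyapunov_before_step (lexx 1) v01 vF (fun _ _ => id) Vxb Fbq; lra.
have [n _ Vxz] := Cxz _ entV.
have [a [c [i [j [Vxa Da [p Fap Vpc] Dc Vcz]]]]] := rel_pow_exit Vxz Dx Dz.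
by apply: (VP p _ a c i j) Vcz => //; exists a.
Qed.

(** * Chains and chain classes of the compactified system, seen in the original space *)

Lemma compact_embedding_preimage (X Y : topologicalType) (iota : X -> Y)
    (K : set Y) : topological_embedding iota -> compact K ->
  K `<=` range iota -> compact (iota @^-1` K).
Proof.
move=> emb cK Kiota F PF FK.
have [w [Kw clw]] := cK (iota @ F) _ FK.
have [x _ xw] := Kiota _ Kw; rewrite -xw in Kw clw.
exists x; split; first by [].
move=> A B FA xB; have [C [oC Cx] CB] := topological_embedding_nbhs emb xB.
have FiA : F (iota @^-1` (iota @` A)) by apply: filterS FA => y Ay; exists y.
have [_ [[y Ay <-] Cy]] := clw _ _ FiA (open_nbhs_nbhs (conj oC Cx)).
by exists y; split=> //; exact: CB.
Qed.

Lemma chain_rel_closure_restrict (R : realType) (X Xhat : uniformType)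
    (iota : X -> Xhat) (f : set (X * X)) (LL : set (Xhat -> R)) (x z : X) :
  locally_compact [set: X] -> proper_compactification iota -> plus_proper f ->
  (forall v, LL v -> elementary_lyapunov (rel_closure iota f) v) ->
  (forall x y, (forall v, LL v -> v (iota x) <= v (iota y)) ->
     x = y \/ chain_rel f (x, y)) ->
  chain_rel (rel_closure iota f) (iota x, iota z) -> chain_rel f (x, z).
Proof.
move=> lX cpt f_proper lyap suff Cxz; have [cXhat _ _ _] := cpt.
have [|yhat fxy yz] := chain_rel_first_step cXhat _ lyap Cxz.
  exact: closed_closure.
have [y {}fxy yE] := rel_closure_at_interior lX cpt f_proper fxy.
have [|<-|Cyz] := suff y z; first by move=> v LLv; rewrite yE; exact: yz.
  exact: sub_chain_rel.
by apply: chain_rel_trans Cyz; exact: sub_chain_rel.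
Qed.

Lemma chain_class_preimage (X Y : uniformType) (iota : X -> Y)
    (f : set (X * X)) (g : set (Y * Y)) (E : set Y) :
  (forall x z, chain_rel g (iota x, iota z) <-> chain_rel f (x, z)) ->
  chain_class g E -> iota @^-1` E !=set0 -> chain_class f (iota @^-1` E).
Proof.
move=> gf cE [x Ex]; have EE := chain_classP cE Ex; exists x.
  by apply/gf; have : E (iota x) by []; rewrite {1}EE => -[].
apply/seteqP; split=> y; rewrite {1}EE /=.
  move=> [/gf Cxy /gf Cyx]; split=> //; exact: chain_rel_trans Cyx Cxy.
by move=> [_ [Cxy Cyx]]; split; exact/gf.
Qed.

Lemma chain_class_subset_range (R : realType) (X Xhat : uniformType)
    (iota : X -> Xhat) (f : set (X * X)) (LL : set (Xhat -> R))
    (E : set Xhat) :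
  locally_compact [set: X] -> proper_compactification iota -> plus_proper f ->
  (forall v, LL v -> elementary_lyapunov (rel_closure iota f) v) ->
  (forall x y, (forall v, LL v -> v (iota x) <= v (iota y)) ->
     x = y \/ chain_rel f (x, y)) ->
  (forall x z, chain_rel f (x, z) ->
     chain_rel (rel_closure iota f) (iota x, iota z)) ->
  chain_class (rel_closure iota f) E ->
  iota @^-1` E !=set0 -> compact (iota @^-1` E) -> E `<=` range iota.
Proof.
move=> lX cpt f_proper lyap suff Cf cE [x Ex] cEX z Ez.
apply: contrapT => zX; have [cXhat hXhat emb _] := cpt.
have iota_cont := topological_embedding_continuous emb.
have EE := chain_classP cE Ex.
have clE : closed (iota @` (iota @^-1` E)).
  apply: compact_closed => //; apply: continuous_compact => //.
  exact: continuous_subspaceT.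
have clX : closed (~` range iota).
  exact/open_closedC/open_range_compactification.
have disj : (iota @` (iota @^-1` E)) `&` (~` range iota) = set0.
  by rewrite -subset0 => _ [[y _ <-]] []; exists y.
have [v [v_cont _ v0 v1]] :=
  @exists_separating_function R _ _ _ cXhat hXhat clE clX disj.
(* [D] is a neighborhood of the trace, where [v] is 0, and it lies inside [X], since [v] is 1
   elsewhere. *)
pose D := [set y | v y <= 2^-1].
have [Cxz Czx] : chain_rel (rel_closure iota f) (iota x, z) /\
    chain_rel (rel_closure iota f) (z, iota x) by move: Ez; rewrite EE.
have clD : closed D.
  by apply: (closed_leR v_cont (v := fun=> 2^-1)) => y; exact: cvg_cst.
have Dx : D (iota x) by rewrite /D /= v0 ?invr_ge0//; exists x.
have Dz : ~ D z by rewrite /D /= v1//; lra.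
have [a [p [Da fap Dp xpz]]] :=
  chain_rel_exit cXhat (@closed_closure _ _) lyap clD Cxz Dx Dz.
(* Being in [D], [a] is a point of [X], and so is its successor [p]. *)
have [a' _ aE] : range iota a.
  by apply: contrapT => /v1 va; move: Da; rewrite /D /= va; lra.
rewrite -aE in fap; have [p' _ pE] := rel_closure_at_interior lX cpt f_proper fap.
have vp : 2^-1 <= v p.
  have : closed [set y | 2^-1 <= v y].
    by apply: (closed_leR (u := fun=> 2^-1) _ v_cont) => y; exact: cvg_cst.
  apply; apply: closureS Dp => y; rewrite /D /=.
  by move=> /negP; rewrite -ltNge => /ltW.
have Ep : ~ E (iota p').
  move=> Ep; have : v (iota p') = 0 by apply: v0; exists p'.
  by rewrite pE => vp0; move: vp; rewrite vp0; lra.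
(* [v'] satisfies [v' x <= v' p <= v' z], and the chain from [z] back to [x] closes the cycle of
   inequalities. *)
have xp v' : LL v' -> v' (iota x) = v' (iota p').
  move=> LLv'; rewrite pE; have /andP[] := xpz _ LLv'.
  have := chain_le (lyap _ LLv') Czx.
  by move=> zx xp' pz; apply/eqP; rewrite eq_le xp' (le_trans pz).
have [|xp'|Cxp] := suff x p'; first by move=> v' /xp ->.
  by apply: Ep; rewrite -xp'.
have [|px'|Cpx] := suff p' x; first by move=> v' /xp ->.
  by apply: Ep; rewrite px'.
by apply: Ep; rewrite EE; split; exact: Cf.
Qed.

(** * Points at infinity *)

(** The zero set of [v] and the image of the support are closed and together cover the dense range,
    hence everything; the second contains no point outside [X]. *)
Lemma compactly_supported_ext_eq0 (R : realType) (X : topologicalType)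
    (Xhat : uniformType) (iota : X -> Xhat) (v : Xhat -> R) (z : Xhat) :
  proper_compactification iota -> continuous v ->
  compactly_supported (v \o iota) -> ~ range iota z -> v z = 0.
Proof.
move=> [_ hXhat emb dX] v_cont [_ cK] zX.
set K := closure _ in cK.
have clK : closed (iota @` K).
  apply: compact_closed => //; apply: continuous_compact => //.
  exact/continuous_subspaceT/topological_embedding_continuous.
have cl0 : closed [set y | v y = 0].
  by apply: (closed_eqR v_cont (v := fun=> 0)) => y; exact: cvg_cst.
have [|//|[x _ xz]] := dense_closed_subset dX (closedU cl0 clK) _ z.
  move=> _ [x _ <-]; have [vx|vx] := eqVneq (v (iota x)) 0; first by left.
  by right; exists x => //; exact: subset_closure.
by case: zX; exists x.
Qed.

Lemma ext_unique (R : realType) (X Xhat : topologicalType) (iota : X -> Xhat)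
    (v w : Xhat -> R) : dense (range iota) -> continuous v -> continuous w ->
  v \o iota = w \o iota -> v = w.
Proof.
move=> dX v_cont w_cont vw; apply/funext.
apply: (dense_closed_subset dX (closed_eqR v_cont w_cont)) => _ [x _ <-].
exact: (congr1 (@^~ x) vw).
Qed.

Lemma bounded_continuous_compact (R : realType) (T : topologicalType)
    (v : T -> R) : compact [set: T] -> continuous v -> bounded_continuous v.
Proof.
move=> cT v_cont; split=> //.
have /compact_bounded /pinfty_ex_gt0[M _ vM] : compact (v @` setT).
  by apply: continuous_compact => //; exact: continuous_subspaceT.
by apply/boundedR; exists M => x; apply: vM; exists x.
Qed.

Lemma ext_extendable (R : realType) (X : topologicalType) (Xhat : uniformType)
    (iota : X -> Xhat) (v : Xhat -> R) : proper_compactification iota ->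
  continuous v -> extendable iota (v \o iota).
Proof.
move=> [cXhat _ emb _] v_cont; split; last by exists v.
apply: bounded_continuous_comp; last exact: bounded_continuous_compact.
exact: topological_embedding_continuous.
Qed.

(* The functions whose extensions agree at [z] and [w] form a closed
   subalgebra containing the generators, hence everything extendable. *)
Lemma eq_outside_range (R : realType) (X : topologicalType)
    (Xhat : uniformType) (iota : X -> Xhat) (LL : set (X -> R)) (z w : Xhat) :
  proper_compactification iota ->
  extendable iota = generated_closed_subalgebra (LL `|` compactly_supported) ->
  closed_subalgebra (@extendable R X Xhat iota) ->
  ~ range iota z -> ~ range iota w ->
  (forall v, continuous v -> LL (v \o iota) -> v z = v w) -> z = w.
Proof.
move=> cpt extE ext_alg zX wX LLzw; have [cXhat hXhat emb dX] := cpt.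
apply: (@eq_of_continuous R) => // v v_cont.
pose B := [set u : X -> R | bounded_continuous u /\
  exists v : Xhat -> R, [/\ continuous v, v \o iota = u & v z = v w]].
have cst_cont c : continuous (cst c : Xhat -> R) by move=> x; exact: cvg_cst.
have [ext_bc ext_cst extD extM ext_lim] := ext_alg.
have : B (v \o iota).
  have : extendable iota (v \o iota) by exact: ext_extendable.
  rewrite extE; apply; split.
    split=> [u []//|c||u v'|u u_bc uB].
    - by split; [exact: ext_bc (ext_cst c)|exists (cst c)].
    - move=> u u' [u_bc [a [a_cont aE azw]]] [u'_bc [b [b_cont bE bzw]]].
      have ab_cont : continuous (a \+ b).
        by move=> x; apply: continuousD; [exact: a_cont|exact: b_cont].
      split; last by exists (a \+ b); split=> //=; rewrite ?azw ?bzw -?aE -?bE.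
      have := ext_extendable cpt ab_cont; case => + _.
      by rewrite -aE -bE.
    - move=> [u_bc [a [a_cont aE azw]]] [u'_bc [b [b_cont bE bzw]]].
      have ab_cont : continuous (a \* b).
        by move=> x; apply: continuousM; [exact: a_cont|exact: b_cont].
      split; last by exists (a \* b); split=> //=; rewrite ?azw ?bzw -?aE -?bE.
      have := ext_extendable cpt ab_cont; case => + _.
      by rewrite -aE -bE.
    (* The limit extends because the extendable functions are sup-norm closed. By density the
       estimates on [X] also hold for the extensions, so [a z] and [a w] differ by at most [e]. *)
    have [|_ [a a_cont aE]] := ext_lim u u_bc.
      move=> e /uB[u' [u'_bc [b [b_cont bE _]]] uu']; exists u' => //.
      by rewrite -bE; exact: ext_extendable.
    split=> //; exists a; split=> //.
    apply/eqP; rewrite -subr_eq0 -normr_le0; apply/ler_addgt0Pl => e e0.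
    have e2 : 0 < e / 2 by lra.
    have [_ [_ [b [b_cont <- bzw]]] ub] := uB _ e2.
    have ab y : `|a y - b y| <= e / 2.
      have ab_cont : continuous (fun y => `|a y - b y|).
        move=> x; apply: (continuous_comp (f := fun y => a y - b y)).
          by apply: continuousB; [exact: a_cont|exact: b_cont].
        exact: norm_continuous.
      have := closed_leR ab_cont (cst_cont (e / 2)).
      move=> /(dense_closed_subset dX); apply => _ [x _ <-] /=.
      by have := ub x; rewrite -aE.
    have := ab z; have := ab w; rewrite bzw addr0.
    by rewrite !ler_norml => /andP[? ?] /andP[? ?]; apply/andP; split; lra.
  move=> u Su; have [u_bc [a a_cont aE]] : extendable iota u.
    by rewrite extE; exact: sub_generated_closed_subalgebra.
  split=> //; exists a; split=> //; case: Su => [LLu|cu].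
    by apply: LLzw => //; rewrite aE.
  by rewrite !(compactly_supported_ext_eq0 cpt a_cont) ?aE.
move=> [_ [a [a_cont aE azw]]].
by rewrite -(ext_unique dX a_cont v_cont aE).
Qed.

(** * The three kinds of classes *)

(** Purely topological once [Ehat] is closed with at most one point outside [X]: an empty trace
    gives the first case, no outside point the third, and a nonempty trace with one outside point
    the second. *)
Lemma chain_class_trichotomy (X Xhat : uniformType) (iota : X -> Xhat)
    (f : set (X * X)) (Ehat : set Xhat) :
  proper_compactification iota -> closed Ehat -> Ehat !=set0 ->
  (iota @^-1` Ehat !=set0 -> chain_class f (iota @^-1` Ehat)) ->
  (forall z w, Ehat z -> Ehat w -> ~ range iota z -> ~ range iota w -> z = w) ->
  (iota @^-1` Ehat !=set0 -> compact (iota @^-1` Ehat) ->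
     Ehat `<=` range iota) ->
  let E := iota @^-1` Ehat in
  exactly_one_of3
    (exists2 z, ~ range iota z & Ehat = [set z])
    [/\ chain_class f E, ~ compact E, closure (iota @` E) = Ehat &
        exists z, Ehat `\` (iota @` E) = [set z]]
    [/\ chain_class f E, compact E & Ehat = iota @` E].
Proof.
move=> [cXhat hXhat emb _] clE [z0 Ez0] classE outE1 compE E.
have EE z : range iota z -> Ehat z -> (iota @` E) z.
  by move=> [x _ <-] Ex; exists x.
have iEE : iota @` E `<=` Ehat by move=> _ [x Ex <-].
have not12 : (exists2 z, ~ range iota z & Ehat = [set z]) -> ~ chain_class f E.
  move=> [z zX Ez] /chain_class_nonempty[x]; rewrite /E Ez /= => xz.
  by apply: zX; exists x.
have cE : Ehat `<=` range iota -> compact E.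
  by apply: compact_embedding_preimage => //; exact: subclosed_compact cXhat _.
split; last first.
  split; first by move=> [/not12 nE [/nE]].
  split; first by move=> [/not12 nE [/nE]].
  by move=> [[_ ncE _ _] [_ /ncE]].
have [[x Ex]|E0] := pselect (E !=set0); last first.
  have z0X : ~ range iota z0.
    by move=> [x _ xz0]; apply: E0; exists x; rewrite /E /= xz0.
  left; exists z0 => //; apply/seteqP; split=> [z Ez|_ ->//].
  apply: outE1 => // -[y _ yz]; apply: E0; exists y.
  by rewrite /E /= yz.
have classfE : chain_class f E by apply: classE; exists x.
right; have [EX|] := pselect (Ehat `<=` range iota).
  right; split=> //; first exact: cE.
  by apply/seteqP; split=> // z Ez; apply: EE => //; exact: EX.
move=> nEX; left.
have ncE : ~ compact E by move=> /compE; apply: contra_not nEX; apply; exists x.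
have [z Ez zX] : exists2 z, Ehat z & ~ range iota z.
  apply: contrapT => noz; apply: nEX => z Ez; apply: contrapT => zX.
  by apply: noz; exists z.
have nzE : ~ (iota @` E) z by move=> [y _ yz]; apply: zX; exists y.
have zE : Ehat `\` (iota @` E) = [set z].
  apply/seteqP; split=> [w [Ew wE]|_ ->//].
  by apply: outE1 => //; move=> /EE /(_ Ew).
have clEE : closure (iota @` E) `<=` Ehat.
  by rewrite [X in _ `<=` X](closure_id Ehat).1//; exact: closureS.
split=> //; last by exists z.
apply/seteqP; split=> // w Ew.
have [wE|wE] := pselect ((iota @` E) w); first exact: subset_closure.
have -> : w = z by have : (Ehat `\` (iota @` E)) w by []; rewrite zE.
(* If [z] were not in the closure, that closure would be a compact subset of the range, with
   preimage [E], making [E] compact. *)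
apply: contrapT => clz; apply: ncE.
have -> : E = iota @^-1` (closure (iota @` E)).
  apply/seteqP; split=> y; first by move=> Ey; apply: subset_closure; exists y.
  exact: clEE.
apply: compact_embedding_preimage => //.
  by apply: (subclosed_compact _ cXhat) => //; exact: closed_closure.
move=> y cly; have [[t _ <-]|nyE] := pselect ((iota @` E) y); first by exists t.
have yz : y = z.
  have : (Ehat `\` (iota @` E)) y by split=> //; exact: clEE.
  by rewrite zE.
by case: clz; rewrite -yz.
Qed.

(** * Cascades and reversibility *)

(** For a single-valued relation, upper semicontinuity is continuity. *)
Lemma closed_functional_rel_graph (T : uniformType) (F : set (T * T)) :
  compact [set: T] -> closed F -> (forall x, exists y, F (x, y)) ->
  (forall x y y', F (x, y) -> F (x, y') -> y = y') ->
  exists2 g : T -> T, continuous g & F = graph g.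
Proof.
move=> cT cF totF funF; have [g gF] := choice totF; exists g.
  move=> x; apply/cvg_app_entourageP => V entV.
  have := closed_rel_usc x cT cF entV.
  by apply: filterS => q /(_ _ (gF q))[y Fxy]; rewrite (funF _ _ _ (gF x) Fxy).
apply/seteqP; split=> -[x y]; first by move=> Fxy; exact: funF Fxy (gF x).
by rewrite /graph /= => ->.
Qed.

(** The domain of the closure is a projection of a compact set, hence closed, and it contains the
    dense range. *)
Lemma rel_closure_total (X : topologicalType) (Xhat : uniformType)
    (iota : X -> Xhat) (f : set (X * X)) :
  compact [set: Xhat] -> hausdorff_space Xhat -> dense (range iota) ->
  (forall x, exists y, f (x, y)) -> forall z, exists w, rel_closure iota f (z, w).
Proof.
move=> cXhat hXhat dX totf z.
have clim : closed (fst @` rel_closure iota f).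
  apply: compact_closed => //; apply: continuous_compact.
    by apply: continuous_subspaceT => t; exact: cvg_fst.
  have cTT : compact [set: Xhat * Xhat] by rewrite -setXTT; exact: compact_setX.
  by apply: (subclosed_compact _ cTT) => //; exact: closed_closure.
have [|[z' w] fzw <-] := dense_closed_subset dX clim _ z; last by exists w.
move=> _ [x _ <-]; have [y fxy] := totf x.
by exists (iota x, iota y) => //; apply: subset_closure; exists (x, y).
Qed.

(** Allows invariance under composition with [g] to be checked on generators only. *)
Lemma closed_subalgebra_pullback (R : realType) (X : topologicalType)
    (A : set (X -> R)) (g : X -> X) : continuous g -> closed_subalgebra A ->
  closed_subalgebra [set u | bounded_continuous u /\ A (u \o g)].
Proof.
move=> g_cont [A_bc A_cst AD AM A_lim].
have bcD (u v : X -> R) : bounded_continuous u -> bounded_continuous v ->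
    bounded_continuous (u \+ v).
  move=> [u_cont /boundedR[M uM]] [v_cont /boundedR[N vN]]; split.
    by move=> x; apply: continuousD; [exact: u_cont|exact: v_cont].
  apply/boundedR; exists (M + N) => x; rewrite (le_trans (ler_normD _ _))//.
  exact: lerD.
have bcM (u v : X -> R) : bounded_continuous u -> bounded_continuous v ->
    bounded_continuous (u \* v).
  move=> [u_cont /boundedR[M uM]] [v_cont /boundedR[N vN]]; split.
    by move=> x; apply: continuousM; [exact: u_cont|exact: v_cont].
  by apply/boundedR; exists (M * N) => x; rewrite normrM ler_pM.
split.
- by move=> u [].
- by move=> c; split; [exact: A_bc (A_cst c)|exact: A_cst].
- by move=> u v [u_bc Au] [v_bc Av]; split; [exact: bcD|exact: AD Au Av].
- by move=> u v [u_bc Au] [v_bc Av]; split; [exact: bcM|exact: AM Au Av].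
- move=> u u_bc uA; split=> //; apply: A_lim; first exact: bounded_continuous_comp.
  by move=> e /uA[v [_ Av] uv]; exists (v \o g) => // x; exact: uv.
Qed.

Lemma compactly_supported_comp (R : realType) (X : topologicalType)
    (g : X -> X) (u : X -> R) : proper_map g -> compactly_supported u ->
  compactly_supported (u \o g).
Proof.
move=> [g_cont gK] [u_cont cK]; split.
  by move=> x; apply: continuous_comp; [exact: g_cont|exact: u_cont].
apply: (subclosed_compact (@closed_closure _ _) (gK _ cK)).
have clK : closed (g @^-1` closure [set x | u x != 0]).
  by apply: closed_comp => [x _|]; [exact: g_cont|exact: closed_closure].
rewrite [X in _ `<=` X](closure_id _).1//; apply: closureS => x ux.
exact: subset_closure.
Qed.

(** Composition with [g] preserves the extendable functions. So for each continuous [v] on [Xhat],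
    the value [v w] at a pair [(z, w)] of the closure is [v' z], with [v'] extending
    [v \o iota \o g]; since such [v] separate points, [z] determines [w]. *)
Lemma cascade_graph (R : realType) (X Xhat : uniformType) (iota : X -> Xhat)
    (LL : set (X -> R)) (g : X -> X) : proper_compactification iota ->
  extendable iota = generated_closed_subalgebra (LL `|` compactly_supported) ->
  closed_subalgebra (@extendable R X Xhat iota) -> proper_map g ->
  (forall u, LL u -> LL (u \o g)) -> cascade iota (graph g).
Proof.
move=> cpt extE ext_alg g_proper LLg; have [cXhat hXhat emb dX] := cpt.
have [g_cont _] := g_proper; have [ext_bc _ _ _ _] := ext_alg.
have ext_g (u : X -> R) : extendable iota u -> extendable iota (u \o g).
  move=> ext_u.
  have : u \in [set u | bounded_continuous u /\ extendable iota (u \o g)].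
    rewrite inE; move: ext_u; rewrite {1}extE; apply; split.
      exact: closed_subalgebra_pullback.
    move=> u' Su'; have ext_u' : extendable iota u'.
      by rewrite extE; exact: sub_generated_closed_subalgebra.
    split; first exact: ext_bc.
    rewrite extE; apply: sub_generated_closed_subalgebra.
    by case: Su' => [/LLg|cu]; [left|right; exact: compactly_supported_comp].
  by rewrite inE => -[].
apply: closed_functional_rel_graph => //; first exact: closed_closure.
  by apply: rel_closure_total => // x; exists (g x).
move=> z w w' zw zw'; apply: (@eq_of_continuous R) => // v v_cont.
have [_ [v' v'_cont v'E]] := ext_g _ (ext_extendable cpt v_cont).
suff vv' : rel_closure iota (graph g) `<=` [set zw | v' zw.1 = v zw.2].
  by rewrite -(vv' _ zw) (vv' _ zw').
apply: rel_closure_subset.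
  have fst_cont : continuous (v' \o fst : Xhat * Xhat -> R).
    by move=> t; apply: continuous_comp; [exact: cvg_fst|exact: v'_cont].
  have snd_cont : continuous (v \o snd : Xhat * Xhat -> R).
    by move=> t; apply: continuous_comp; [exact: cvg_snd|exact: v_cont].
  exact: closed_eqR fst_cont snd_cont.
by move=> x y; rewrite /graph /= => ->; exact: (congr1 (@^~ x) v'E).
Qed.

Lemma rel_closure_inv (X Xhat : topologicalType) (iota : X -> Xhat)
    (f : set (X * X)) (z w : Xhat) :
  rel_closure iota f (z, w) -> rel_closure iota (f^-1)%relation (w, z).
Proof.
move=> fzw B -[[P Q] [/= wP zQ] PQB].
have /fzw[_ [[[x y] fxy <-] [/= Qx Py]]] : nbhs (z, w) (Q `*` P).
  by exists (Q, P).
exists (iota y, iota x); split; last by apply: PQB.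
by exists (y, x).
Qed.

Lemma homeomorphism_proper (X : topologicalType) (g h : X -> X) :
  cancel g h -> cancel h g -> continuous g -> continuous h -> proper_map g.
Proof.
move=> gh hg g_cont h_cont; split=> // K cK.
rewrite (_ : g @^-1` K = h @` K).
  by apply: continuous_compact => //; exact: continuous_subspaceT.
apply/seteqP; split=> [x Kgx|_ [y Ky <-] /=]; last by rewrite hg.
by exists (g x).
Qed.

(** Closure commutes with inversion of relations, so the two extended maps have mutually inverse
    graphs. *)
Lemma reversible_graph (X Xhat : topologicalType) (iota : X -> Xhat)
    (g h : X -> X) : cancel g h -> cancel h g ->
  cascade iota (graph g) -> cascade iota (graph h) -> reversible iota (graph g).
Proof.
move=> gh hg [ghat ghat_cont gE] [hhat hhat_cont hE].
have inv_gh : ((graph g)^-1)%relation = graph h.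
  by apply/seteqP; split=> -[x y]; rewrite /graph /= => ->; rewrite ?gh ?hg.
have inv_hg : ((graph h)^-1)%relation = graph g.
  by apply/seteqP; split=> -[x y]; rewrite /graph /= => ->; rewrite ?gh ?hg.
exists ghat => //; exists hhat; split=> // z.
  have : rel_closure iota (graph g) (z, ghat z) by rewrite gE.
  by move=> /rel_closure_inv; rewrite inv_gh hE.
have : rel_closure iota (graph h) (z, hhat z) by rewrite hE.
by move=> /rel_closure_inv; rewrite inv_hg gE.
Qed.

Theorem theorem0p4 (R : realType) (X : uniformType)
    (X_hausdorff : hausdorff_space X)
    (X_loc_compact : locally_compact [set: X])
    (X_sigma_compact : sigma_compact X)
    (f : set (X * X)) (f_proper : plus_proper f)
    (LL : set (X -> R)) (LL_unif : LL `<=` bounded_unif_continuous)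
    (LL_lyapunov : forall L, LL L -> elementary_lyapunov f L)
    (LL_sufficient : sufficient f LL)
    (Xhat : uniformType) (iota : X -> Xhat)
    (Xhat_compactification : proper_compactification iota)
    (Xhat_algebra : extendable iota =
      generated_closed_subalgebra (LL `|` compactly_supported)) :
  let fhat := rel_closure iota f in
  [/\ chain_dynamic iota f,
      (forall Ehat : set Xhat, chain_class fhat Ehat ->
         let E := iota @^-1` Ehat in
         exactly_one_of3
           (exists2 z, ~ range iota z & Ehat = [set z])
           [/\ chain_class f E, ~ compact E, closure (iota @` E) = Ehat &
               exists z, Ehat `\` (iota @` E) = [set z]]
           [/\ chain_class f E, compact E & Ehat = iota @` E]),
      (forall g : X -> X, f = graph g -> unif_continuous g -> proper_map g ->
         (forall u, LL u -> LL (u \o g)) -> cascade iota f) &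
      (forall g : X -> X, f = graph g -> uniform_isomorphism g ->
         [set u \o g | u in LL] = LL -> reversible iota f)].
Proof.
have [cXhat hXhat emb dX] := Xhat_compactification.
have gen_unif : LL `|` compactly_supported `<=` bounded_unif_continuous.
  by move=> u [/LL_unif//|]; exact: compactly_supported_unif_continuous.
have unif_alg := closed_subalgebra_bounded_unif_continuous R X.
have ext_alg : closed_subalgebra (@extendable R X Xhat iota).
  rewrite Xhat_algebra; exact: closed_subalgebra_generated unif_alg gen_unif.
have LL_ext u : LL u -> extendable iota u.
  by move=> LLu; rewrite Xhat_algebra; apply: sub_generated_closed_subalgebra; left.
(* The bounded uniformly continuous functions are a closed subalgebra containing the generators, so
   every extendable function is uniformly continuous on [X]. *)
have iota_uc : unif_continuous iota.
  apply: (@unif_continuous_compactification R) => // v v_cont.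
  have := ext_extendable Xhat_compactification v_cont.
  by rewrite Xhat_algebra => /(_ bounded_unif_continuous)[].
pose LLhat := [set v : Xhat -> R | continuous v /\ LL (v \o iota)].
have lyap v : LLhat v -> elementary_lyapunov (rel_closure iota f) v.
  move=> [v_cont /LL_lyapunov lyap_v].
  exact: elementary_lyapunov_rel_closure lyap_v v_cont erefl.
have LL_suff x y : (forall v, LLhat v -> v (iota x) <= v (iota y)) ->
    x = y \/ chain_rel f (x, y).
  move=> LLxy; suff : (diagonal `|` chain_rel f) (x, y) by [].
  rewrite LL_sufficient => L LL_L; have [_ [v v_cont vE]] := LL_ext L LL_L.
  by rewrite /le_rel /= -vE; apply: LLxy; split; rewrite ?vE.
have Cf x z :
    chain_rel f (x, z) -> chain_rel (rel_closure iota f) (iota x, iota z).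
  apply: chain_rel_homo => // a b fab.
  by apply: subset_closure; exists (a, b).
have Chat x z :
    chain_rel (rel_closure iota f) (iota x, iota z) <-> chain_rel f (x, z).
  split; last exact: Cf.
  exact: chain_rel_closure_restrict X_loc_compact _ f_proper lyap LL_suff.
split.
- by split=> //; apply/seteqP; split=> -[x z] /Chat.
- move=> Ehat cE; apply: chain_class_trichotomy => //.
  + by apply: closed_chain_class cE => //; exact: closed_closure.
  + exact: chain_class_nonempty cE.
  + exact: chain_class_preimage Chat cE.
  + move=> z w Ez Ew zX wX.
    apply: (eq_outside_range Xhat_compactification Xhat_algebra ext_alg zX wX).
    move=> v v_cont LLv; have lyap_v := lyap v (conj v_cont LLv).
    move: Ew; rewrite (chain_classP cE Ez) => -[Czw Cwz].
    by apply/eqP; rewrite eq_le !(chain_le lyap_v).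
  + exact: chain_class_subset_range X_loc_compact _ f_proper lyap LL_suff Cf cE.
- move=> g fE _ g_proper LLg; rewrite fE.
  exact: cascade_graph Xhat_compactification Xhat_algebra ext_alg g_proper LLg.
- move=> g fE [h [gh hg g_uc h_uc]] LLg; rewrite fE.
  have g_cont := unif_continuous_continuous g_uc.
  have h_cont := unif_continuous_continuous h_uc.
  apply: (reversible_graph gh hg).
    apply: (cascade_graph Xhat_compactification Xhat_algebra ext_alg).
      exact: homeomorphism_proper gh hg g_cont h_cont.
    by move=> u LLu; rewrite -LLg; exists u.
  apply: (cascade_graph Xhat_compactification Xhat_algebra ext_alg).
    exact: homeomorphism_proper hg gh h_cont g_cont.
  (* Surjectivity of composition with [g] on [LL] writes [u] as [u' \o g], so [u \o h] is [u'],
     again in [LL]. *)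
  move=> u; rewrite -{1}LLg => -[u' LLu' <-].
  by rewrite (_ : (u' \o g) \o h = u')//; apply/funext => x /=; rewrite hg.
Qed.
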